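(* Let $n \geq 1$, fix $\lambda \in (0,1)$ and a unit vector $\mathbf{v} \in \mathbb{R}^n$. Suppose $g: \mathbb{R}^n \to \mathbb{R}$ is continuously differentiable ($g \in C^1(\mathbb{R}^n)$) and satisfies $$g\left(\mathbf{x}+(1-2\lambda)h\mathbf{v}\right) = \frac{1}{|B_h(\mathbf{x})|} \int_{B_h(\mathbf{x})} g(\mathbf{t})\, dV$$ for all $\mathbf{x} \in \mathbb{R}^n$ and all $h > 0$. Then $g$ is a harmonic function. Further, if $\lambda \neq \tfrac{1}{2}$, then $g$ is constant in the $\mathbf{v}$-direction, i.e., $\frac{\partial g}{\partial \mathbf{v}} = 0$ identically on $\mathbb{R}^n$.
   Context: $B_h(\mathbf{x})$ denotes the Euclidean ball of radius $h$ centered at $\mathbf{x}$ in $\mathbb{R}^n$, $|B_h(\mathbf{x})|$ denotes its volume, and $dV$ is the standard Euclidean volume measure (integration in the variable $\mathbf{t}$). A function $g:\mathbb{R}^n\to\mathbb{R}$ is harmonic if it is twice differentiable and the sum of its second partial derivatives $\sum_{i=1}^n \partial_i^2 g$ is identically $0$. $\frac{\partial g}{\partial \mathbf{v}}$ denotes the directional derivative of $g$ in the direction $\mathbf{v}$. *)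

(* Defs.v *)
From HB Require Import structures.
From mathcomp Require Import all_boot all_order all_algebra.
From mathcomp Require Import all_classical all_reals all_analysis.

Set Implicit Arguments.
Unset Strict Implicit.
Unset Printing Implicit Defensive.
Import Order.TTheory GRing.Theory Num.Theory.
Import numFieldNormedType.Exports.

Local Open Scope classical_set_scope.
Local Open Scope ring_scope.

Definition measure_rV_display : measure_display -> measure_display.
Proof. exact. Qed.

Section measurable_rV.
Context {d} {T : measurableType d}.
Variable n : nat.

Let coors : 'I_n -> 'rV[T]_n -> T := fun i x => x ord0 i.

Let rV_set0 : g_sigma_preimage coors set0.
Proof. exact: sigma_algebra0. Qed.

Let rV_setC A : g_sigma_preimage coors A -> g_sigma_preimage coors (~` A).
Proof. exact: sigma_algebraC. Qed.

Let rV_bigcup (F : (set 'rV[T]_n)^nat) :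
  (forall i, g_sigma_preimage coors (F i)) ->
  g_sigma_preimage coors (\bigcup_i (F i)).
Proof. exact: sigma_algebra_bigcup. Qed.

HB.instance Definition _ := @isMeasurable.Build (measure_rV_display d)
  'rV[T]_n (g_sigma_preimage coors) rV_set0 rV_setC rV_bigcup.

Lemma measurable_coord_rV (i : 'I_n) :
  measurable_fun [set: 'rV[T]_n] (fun x : 'rV[T]_n => x ord0 i).
Proof.
move=> _ Y mY; rewrite setTI; apply: sub_sigma_algebra => /=.
rewrite -bigcup_seq/=; exists i => /=; first by rewrite mem_index_enum.
by exists Y => //; rewrite setTI.
Qed.

End measurable_rV.


Lemma measurable_fun_rV d1 d2 (T1 : measurableType d1) (T2 : measurableType d2)
    n (f : T1 -> 'rV[T2]_n) :
  (forall i, measurable_fun [set: T1] (fun x => f x ord0 i)) ->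
  measurable_fun [set: T1] f.
Proof.
move=> mf _ Y mY; rewrite setTI.
pose G : set (set 'rV[T2]_n) := [set A | measurable (f @^-1` A)].
suff: measurable `<=` G by move=> /(_ _ mY).
apply: smallest_sub => /=.
  split.
  - by rewrite /G/= preimage_set0.
  - by move=> A GA; rewrite /G/= setTD preimage_setC; exact: measurableC.
  - by move=> F GF; rewrite /G/= preimage_bigcup; exact: bigcupT_measurable.
move=> A; rewrite -bigcup_seq/= => -[i _ [B mB <-]]; rewrite /G/= setTI.
by have := mf i measurableT B mB; rewrite setTI.
Qed.

Section lebesgue_measure_rV.
Context {R : realType}.
Local Open Scope ereal_scope.

Definition cons_rV n (p : measurableTypeR R * 'rV[R]_n) : 'rV[R]_n.+1 :=
  row_mx (p.1%:M : 'rV[R]_1) p.2.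

Definition uncons_rV n (x : 'rV[R]_n.+1) : measurableTypeR R * 'rV[R]_n :=
  (x ord0 ord0, \row_i x ord0 (lift ord0 i)).

Lemma cons_rV0 n (p : measurableTypeR R * 'rV[R]_n) : cons_rV p ord0 ord0 = p.1.
Proof.
rewrite /cons_rV (_ : ord0 = lshift n (ord0 : 'I_1)); last exact: val_inj.
by rewrite (row_mxEl (p.1%:M : 'rV[R]_1)) mxE eqxx.
Qed.

Lemma cons_rVS n (p : measurableTypeR R * 'rV[R]_n) (i : 'I_n) :
  cons_rV p ord0 (lift ord0 i) = p.2 ord0 i.
Proof.
rewrite /cons_rV (_ : lift ord0 i = rshift 1 i); last exact: val_inj.
by rewrite (row_mxEr (p.1%:M : 'rV[R]_1)).
Qed.

Lemma measurable_cons_rV n : measurable_fun setT (@cons_rV n).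
Proof.
apply: measurable_fun_rV => i; case: (unliftP ord0 i) => [j ->|->].
  under eq_fun do rewrite cons_rVS.
  exact: measurableT_comp (measurable_coord_rV j) measurable_snd.
under eq_fun do rewrite cons_rV0.
exact: measurable_fst.
Qed.

Lemma measurable_uncons_rV n : measurable_fun setT (@uncons_rV n).
Proof.
apply: measurable_fun_pair; first exact: measurable_coord_rV.
apply: measurable_fun_rV => i.
under eq_fun do rewrite mxE.
exact: measurable_coord_rV.
Qed.

Lemma cons_rVK n : cancel (@cons_rV n) (@uncons_rV n).
Proof.
move=> [a x]; rewrite /uncons_rV cons_rV0; congr pair.
by apply/rowP => i; rewrite mxE cons_rVS.
Qed.

(* 'rV[R]_n carries the product sigma-algebra; its Lebesgue measure is the image
   of the iterated product measure under R * R^n -> R^(1 + n), starting from the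
   unit mass on the one-point space R^0. The fixpoint is on bare set functions;
   its sigma-finite measure structure and its values on boxes follow. *)
Fixpoint lebesgue_measure_rV (n : nat) : set 'rV[R]_n -> \bar R :=
  match n with
  | 0 => \d_(0%R : 'rV[R]_0)
  | m.+1 => pushforward (@lebesgue_measure R \x @lebesgue_measure_rV m)
              (@cons_rV m)
  end.


Section step.
Variables (n : nat) (mu : {sigma_finite_measure set 'rV[R]_n -> \bar R}).

Let nu := pushforward (@lebesgue_measure R \x mu) (@cons_rV n).

Let nu0 : nu set0 = 0.
Proof. by rewrite /nu /pushforward preimage_set0 measure0. Qed.

Let nu_ge0 A : 0 <= nu A.
Proof.
exact: (@measure_ge0 _ _ _
  (measure_function_pushforward__canonical__measure_function_Measure
    (@lebesgue_measure R \x mu)%E (@measurable_cons_rV n))).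
Qed.

Let nu_sigma_additive : semi_sigma_additive nu.
Proof.
exact: (@measure_semi_sigma_additive _ _ _
  (measure_function_pushforward__canonical__measure_function_Measure
    (@lebesgue_measure R \x mu)%E (@measurable_cons_rV n))).
Qed.

HB.instance Definition _ := isMeasure.Build _ _ _ nu
  nu0 nu_ge0 nu_sigma_additive.

Let nu_sigma_finite : sigma_finite setT nu.
Proof.
have /sigma_finiteP[F [TF ndF Foo]] := sigma_finiteT (@lebesgue_measure R).
have /sigma_finiteP[G [TG ndG Goo]] := sigma_finiteT mu.
exists (fun k => @uncons_rV n @^-1` (F k `*` G k)).
  rewrite -preimage_bigcup -[LHS](@preimage_setT _ _ (@uncons_rV n)).
  congr (_ @^-1` _); rewrite -setXTT TF TG; apply/seteqP; split=> -[x y].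
    move=> [/= [k _ Fkx] [l _ Gly]]; exists (maxn k l) => //; split.
    - by move: x Fkx; exact/subsetPset/ndF/leq_maxl.
    - by move: y Gly; exact/subsetPset/ndG/leq_maxr.
  by move=> [k _ [/= ? ?]]; split; exists k.
move=> k; have [mF Fk] := Foo k; have [mG Gk] := Goo k; split.
  rewrite -[X in measurable X]setTI; apply: measurable_uncons_rV => //.
  exact: measurableX.
rewrite /nu /pushforward -comp_preimage (_ : _ \o _ = id); last first.
  by apply/funext => x /=; rewrite cons_rVK.
rewrite preimage_id; apply: (@le_lt_trans _ _ (lebesgue_measure (F k) * mu (G k))).
  by rewrite product_measure1E.
by rewrite lte_mul_pinfty// ge0_fin_numE.
Qed.

HB.instance Definition _ := Measure_isSigmaFinite.Build _ _ _ nu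
  nu_sigma_finite.

Definition lebesgue_measure_rV_step
  : {sigma_finite_measure set 'rV[R]_n.+1 -> \bar R} := nu.

End step.

Let mu_ n : {sigma_finite_measure set 'rV[R]_n -> \bar R} :=
  nat_rect (fun m => {sigma_finite_measure set 'rV[R]_m -> \bar R})
    (\d_(0%R : 'rV[R]_0)) lebesgue_measure_rV_step n.

Let mu_E n : @lebesgue_measure_rV n = mu_ n :> (set _ -> _).
Proof. by elim: n => //= n ->. Qed.

Let lebesgue_measure_rV0 n : @lebesgue_measure_rV n set0 = 0.
Proof. by rewrite mu_E. Qed.

Let lebesgue_measure_rV_ge0 n A : 0 <= @lebesgue_measure_rV n A.
Proof. by rewrite mu_E. Qed.

Let lebesgue_measure_rV_sigma_additive n :
  semi_sigma_additive (@lebesgue_measure_rV n).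
Proof. by rewrite mu_E; exact: measure_semi_sigma_additive. Qed.

HB.instance Definition _ n := isMeasure.Build _ _ _ (@lebesgue_measure_rV n)
  (@lebesgue_measure_rV0 n) (@lebesgue_measure_rV_ge0 n)
  (@lebesgue_measure_rV_sigma_additive n).

Let lebesgue_measure_rV_sigma_finite n :
  sigma_finite setT (@lebesgue_measure_rV n).
Proof. by rewrite mu_E; exact: sigma_finiteT. Qed.

HB.instance Definition _ n := Measure_isSigmaFinite.Build _ _ _
  (@lebesgue_measure_rV n) (@lebesgue_measure_rV_sigma_finite n).

Lemma lebesgue_measure_rV_box n (A : 'I_n -> set R) :
  (forall i, measurable (A i)) ->
  lebesgue_measure_rV [set x : 'rV[R]_n | forall i, A i (x ord0 i)] =
  \prod_(i < n) lebesgue_measure (A i).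
Proof.
elim: n A => [A _|n IHn A mA].
  by rewrite big_ord0 /= diracE mem_set//= => -[].
pose B := [set x : 'rV[R]_n | forall i, A (lift ord0 i) (x ord0 i)].
have mB : measurable B.
  rewrite (_ : B = \bigcap_(i in [set: 'I_n])
    ((fun x : 'rV[R]_n => x ord0 i) @^-1` A (lift ord0 i))); last first.
    by apply/seteqP; split=> [x /= Ax i _|x /= Ax i]; apply: Ax.
  apply: fin_bigcap_measurable; first exact: finite_finset.
  move=> i _; rewrite -[X in measurable X]setTI.
  by apply: measurable_coord_rV => //; exact: mA.
rewrite big_ord_recl -IHn; last by move=> i; exact: mA.
rewrite -[RHS](@product_measure1E _ _ _ _ _ (@lebesgue_measure R)
  (@lebesgue_measure_rV n) (A ord0) B)//=; last exact: mA.
rewrite /pushforward; congr (product_measure1 _ _ _).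
apply/seteqP; split=> -[a x] /=.
  move=> Ax; split=> [|i]; first by have := Ax ord0; rewrite cons_rV0.
  by have := Ax (lift ord0 i); rewrite cons_rVS.
move=> [Aa Ax] i; case: (unliftP ord0 i) => [j ->|->].
  by rewrite cons_rVS; exact: Ax.
by rewrite cons_rV0.
Qed.

End lebesgue_measure_rV.
Arguments lebesgue_measure_rV {R n}.

(* The library's norm on 'rV[R]_n is the sup norm, with cubes as balls. It defines
   the same topology and differentiability as the Euclidean norm. *)
Definition euclidean_norm {R : realType} {n : nat} (x : 'rV[R]_n) : R :=
  Num.sqrt (\sum_(i < n) x ord0 i ^+ 2).

Definition euclidean_ball {R : realType} {n : nat} (x : 'rV[R]_n) (h : R) :
  set 'rV[R]_n := [set t | euclidean_norm (t - x) < h].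

Definition ball_mean {R : realType} {n : nat} (g : 'rV[R]_n -> R)
    (x : 'rV[R]_n) (h : R) : R :=
  (fine (lebesgue_measure_rV (euclidean_ball x h)))^-1 *
  \int[lebesgue_measure_rV]_(t in euclidean_ball x h) g t.

Definition partial {R : realType} {n : nat} (i : 'I_n) (g : 'rV[R]_n -> R) :
  'rV[R]_n -> R := 'D_(delta_mx ord0 i) g.

Definition continuously_differentiable {R : realType} {n : nat}
    (g : 'rV[R]_n -> R) : Prop :=
  (forall x, differentiable g x) /\ (forall i, continuous (partial i g)).

Definition twice_differentiable {R : realType} {n : nat}
    (g : 'rV[R]_n -> R) : Prop :=
  (forall x, differentiable g x) /\
  (forall i x, differentiable (partial i g) x).

Definition harmonic_function {R : realType} {n : nat} (g : 'rV[R]_n -> R) :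
    Prop :=
  twice_differentiable g /\
  (forall x, \sum_(i < n) partial i (partial i g) x = 0).

(* Main.v *)
Require Import Defs.
From HB Require Import structures.
From mathcomp Require Import all_boot all_order all_algebra.
From mathcomp Require Import all_classical all_reals all_analysis.
From mathcomp Require Import measurable_realfun.
From mathcomp Require Import ring lra.
Import Order.TTheory GRing.Theory Num.Theory.
Import numFieldNormedType.Exports.
Local Open Scope classical_set_scope.
Local Open Scope ring_scope.

(** Write [c = 1 - 2 lam].  The first step is to remove the shift.  If [c <> 0],
    expand [g (x + z) = g x + l z + o(|z|)] with [l] the differential of [g] at [x],
    and average over the ball of radius [h] about [x].  The ball is symmetric about
    [x] and [l] is odd, so the linear term has mean zero; the mean over the ball is
    therefore [g x + o(h)], whereas the hypothesis says that it is
    [g (x + c h v) = g x + c h l v + o(h)].  Hence [l v = 0]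
    ([derive_eq0_of_shifted_mean]).  A vanishing derivative along [v] makes [g]
    constant on every line of direction [v] ([derive_eq0_translate]), so the shift
    is invisible; in all cases [g] has the ordinary mean value property.

    It remains to show that a continuous function [g] with the mean value property is
    twice differentiable and has vanishing Laplacian ([harmonic_of_mean_value]).
    Write [conv K g x] for the integral of [K (t - x) g t] over [t].  If the
    superlevel sets of [K >= 0] are balls centred at the origin, slicing [K] into
    these sets (layer cake and Fubini) and applying the mean value property to each
    slice gives [conv K g = g * conv K 1] ([conv_mean_value]).  This is used with
    [bump k y = max (0, 1 - |y|^2)^k] for [k = 1, 2, 3].

    With [k = 3] the identity writes [g] as a constant multiple of [conv (bump 3) g],
    and derivatives can be moved onto the kernel.  A kernel with a first order Taylor
    expansion whose remainder is uniformly quadratic gives a differentiable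
    convolution, simply by integrating the remainder over a bounded region
    ([conv_differentiable]).  Both [bump 3] and its first partial derivatives, which
    are multiples of [y_i bump 2 y], have such an expansion, so [g] is twice
    differentiable.

    The Laplacian of [bump 3] is a linear combination of [bump 2] and [bump 1]; by
    the reproducing identity the Laplacian of [conv (bump 3) g] at [x] is thus [g x]
    times the same expression for the constant function 1.  But [conv (bump 3) 1] is
    a constant function ([conv_bump_cst]), so that expression is 0, and no integral
    has to be evaluated. *)

(** * Euclidean space as a measurable space; reflection invariance *)

Section rV_measure.
Set Implicit Arguments.
Unset Strict Implicit.
Unset Printing Implicit Defensive.
Context {R : realType}.
Implicit Types n : nat.

Lemma coord_le_norm n (x : 'rV[R]_n) i : `|x ord0 i| <= `|x|.
Proof.
rewrite [leRHS]/Num.norm/= mx_normrE.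
exact: (le_bigmax _ (fun k => `|x k.1 k.2|) (ord0, i)).
Qed.

Lemma norm_rV_le n (x : 'rV[R]_n) c : 0 <= c ->
  (forall i, `|x ord0 i| <= c) -> `|x| <= c.
Proof.
move=> c0 H; rewrite [leLHS]/Num.norm/= mx_normrE.
by apply/bigmax_leP; split => //= -[i j] _ /=; rewrite (ord1 i).
Qed.

Lemma norm_rV_lt n (x : 'rV[R]_n) c : 0 < c ->
  (`|x| < c) = [forall i, `|x ord0 i| < c].
Proof.
move=> c0; apply/idP/forallP => [xc i|H].
  exact: le_lt_trans (coord_le_norm _ _) xc.
rewrite [ltLHS]/Num.norm/= mx_normrE.
by apply/bigmax_ltP; split => //= -[i j] _ /=; rewrite (ord1 i).
Qed.

Lemma measurable_box n (A : 'I_n -> set R) : (forall i, measurable (A i)) ->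
  measurable [set x : 'rV[R]_n | forall i, A i (x ord0 i)].
Proof.
move=> mA; rewrite (_ : [set _ | _] = \bigcap_(i in [set: 'I_n])
    ((fun x : 'rV[R]_n => x ord0 i) @^-1` A i)); last first.
  by apply/seteqP; split=> [x /= Ax i _|x /= Ax i]; apply: Ax.
apply: fin_bigcap_measurable; first exact: finite_finset.
move=> i _; rewrite -[X in measurable X]setTI.
by apply: measurable_coord_rV => //; exact: mA.
Qed.

Lemma open_cube_itv n (q : 'rV[R]_n) e : 0 < e ->
  [set t | `|t - q| < e] =
  [set t : 'rV[R]_n | forall i, `]q ord0 i - e, q ord0 i + e[%classic (t ord0 i)].
Proof.
move=> e0; apply/seteqP; split => t /=.
  rewrite norm_rV_lt// => /forallP H i; move: (H i).
  by rewrite !mxE in_itv/= ltr_distl.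
move=> H; rewrite norm_rV_lt//; apply/forallP => i; move: (H i).
by rewrite !mxE in_itv/= ltr_distl.
Qed.

Lemma closed_cube_itv n (q : 'rV[R]_n) e : 0 <= e ->
  [set t | `|t - q| <= e] =
  [set t : 'rV[R]_n | forall i, `[q ord0 i - e, q ord0 i + e]%classic (t ord0 i)].
Proof.
move=> e0; apply/seteqP; split => t /=.
  move=> H i; rewrite in_itv/= -ler_distl; apply: le_trans H.
  by have := coord_le_norm (t - q) i; rewrite !mxE.
move=> H; apply: norm_rV_le => // i; move: (H i).
by rewrite !mxE in_itv/= ler_distl.
Qed.

(** The topology of [R^n] has a countable base, the cubes with rational centre and
    radius [1/(k+1)], and cubes are boxes; hence Borel sets belong to the product
    sigma-algebra, and continuous functions are measurable. *)
Lemma open_measurable_rV n (U : set 'rV[R]_n) : open U -> measurable U.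
Proof.
move=> oU.
pose Q (p : 'rV[rat]_n * nat) : set 'rV[R]_n :=
  [set t | `|t - map_mx ratr p.1| < p.2.+1%:R^-1].
have -> : U = \bigcup_(p in [set p | Q p `<=` U]) Q p.
  apply/seteqP; split => [x Ux|x [p /= pU Qx]]; last exact: pU.
  have /nbhs_ballP[e /= e0 eU] : nbhs x U by exact: open_nbhs_nbhs.
  have [k ke] : exists k : nat, k.+1%:R^-1 < e / 2.
    have [k _ kP] := near_infty_natSinv_lt (PosNum (divr_gt0 e0 (@ltr0n R 2))).
    by exists k; apply: (kP k) => /=.
  set d : R := k.+1%:R^-1 in ke.
  have d0 : 0 < d by rewrite invr_gt0.
  have Hq i : exists q : rat, `|x ord0 i - ratr q| < d.
    have : x ord0 i - d < x ord0 i + d by lra.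
    move=> /rat_in_itvoo[q]; rewrite in_itv/= => /andP[q1 q2].
    by exists q; rewrite ltr_distl; apply/andP; split; lra.
  have [q Hq'] := choice Hq.
  have Qx : Q (\row_i q i, k) x.
    by rewrite /Q/= norm_rV_lt//; apply/forallP => i; rewrite !mxE.
  exists (\row_i q i, k) => //= t Qt; apply: eU.
  rewrite -ball_normE/=.
  have -> : x - t = (x - map_mx ratr (\row_i q i)) - (t - map_mx ratr (\row_i q i)).
    by rewrite opprB addrA subrK.
  apply: le_lt_trans (ler_normB _ _) _.
  by move: Qx Qt; rewrite /Q/= -/d; lra.
rewrite bigcup_mkcond; apply: countable_bigcupT_measurable.
  exact: (@countableP ('rV[rat]_n * nat)%type setT).
move=> p; case: ifPn => // _; rewrite /Q open_cube_itv ?invr_gt0//.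
pose q := map_mx (@ratr R) p.1; pose d := p.2.+1%:R^-1 : R.
exact: (measurable_box (A := fun i => `]q ord0 i - d, q ord0 i + d[%classic)).
Qed.

Lemma continuous_measurable_rV n (f : 'rV[R]_n -> R) :
  continuous f -> measurable_fun setT f.
Proof.
move=> /continuousP cf; apply: (measurability _ (RGenOpens.measurableE R)).
move=> _ [_ [a [b ->] <-]]; rewrite setTI; apply: open_measurable_rV.
exact/cf/interval_open.
Qed.

Lemma measurable_cube n (x : 'rV[R]_n) e : 0 <= e ->
  measurable [set t | `|t - x| <= e].
Proof.
move=> e0; rewrite closed_cube_itv//.
exact: (measurable_box (A := fun i => `[x ord0 i - e, x ord0 i + e]%classic)).
Qed.

Lemma cube_lty n (x : 'rV[R]_n) e : 0 <= e ->
  (lebesgue_measure_rV [set t | `|t - x| <= e]%R < +oo)%E.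
Proof.
move=> e0; pose A i := `[x ord0 i - e, x ord0 i + e]%classic.
rewrite closed_cube_itv// (lebesgue_measure_rV_box (A := A)); last first.
  by move=> i; exact: measurable_itv.
rewrite ltey; apply/eqP => oo.
have : (\prod_(i < n) lebesgue_measure (A i))%E \is a fin_num.
  by apply: prode_fin_num => i _; rewrite /A lebesgue_measure_itv/=; case: ifP.
by rewrite oo.
Qed.

Lemma lebesgue_measure_reflect1 (a : R) (A : set (measurableTypeR R)) :
  measurable A ->
  lebesgue_measure ((fun t : measurableTypeR R => a - t : measurableTypeR R) @^-1` A)
  = lebesgue_measure A.
Proof.
move=> mA.
have mf : measurable_fun setT (fun t : measurableTypeR R => a - t : measurableTypeR R).
  by exact: measurable_funB.
apply/esym; pose nu : {measure set (measurableTypeR R) -> \bar R} :=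
  measure_function_pushforward__canonical__measure_function_Measure lebesgue_measure mf.
apply: (@lebesgue_measure_unique R nu) => //= _ [[b c]] _ <-.
rewrite /pushforward (_ : _ @^-1` _ = `[a - c, a - b[%classic); last first.
  by apply/seteqP; split => t /=; rewrite !in_itv/= => /andP[? ?]; apply/andP; split; lra.
rewrite !lebesgue_measure_itv/= !lte_fin.
rewrite (_ : (a - c < a - b) = (b < c)); last by apply/idP/idP; lra.
by case: ifP => // _; rewrite -!EFinB; congr (_%:E); ring.
Qed.

Lemma measurable_reflect n (a : 'rV[R]_n) :
  measurable_fun setT (fun t : 'rV[R]_n => a - t).
Proof.
apply: measurable_fun_rV => i; under eq_fun do rewrite !mxE.
by apply: measurable_funB => //; exact: measurable_coord_rV.
Qed.

(** Induction on the dimension: both sides are measures on a product that agree on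
    rectangles.  Reflections are the only symmetries needed below, since a
    translation of the integration variable followed by [t |-> - t] is one of them. *)
Lemma lebesgue_measure_reflect n (a : 'rV[R]_n) (A : set 'rV[R]_n) :
  measurable A ->
  lebesgue_measure_rV ((fun t => a - t) @^-1` A) = lebesgue_measure_rV A.
Proof.
elim: n a A => [a A mA|n IHn a A mA].
  by congr (lebesgue_measure_rV _); apply/seteqP; split => t /=;
    rewrite (thinmx0 (a - t)) (thinmx0 t).
pose S (t : measurableTypeR R) : measurableTypeR R := a ord0 ord0 - t.
pose a' : 'rV[R]_n := \row_i a ord0 (lift ord0 i).
pose T (p : measurableTypeR R * 'rV[R]_n) := (S p.1, a' - p.2).
have mS : measurable_fun setT S by exact: measurable_funB.
have mT : measurable_fun setT T.
  apply: measurable_fun_pair; first exact: measurableT_comp mS measurable_fst.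
  exact: measurableT_comp (measurable_reflect _) measurable_snd.
have consT p : a - cons_rV p = cons_rV (T p).
  apply/rowP => i; rewrite [LHS]mxE [X in _ + X]mxE.
  case: (unliftP ord0 i) => [j ->|->].
    by rewrite !cons_rVS /T/= !mxE.
  by rewrite !cons_rV0.
pose nu : {measure set (measurableTypeR R * 'rV[R]_n) -> \bar R} :=
  measure_function_pushforward__canonical__measure_function_Measure
    (lebesgue_measure \x lebesgue_measure_rV)%E mT.
rewrite /= /pushforward.
have mconsA : measurable (@cons_rV R n @^-1` A).
  by rewrite -[X in measurable X]setTI; exact: measurable_cons_rV.
rewrite (_ : _ @^-1` (_ @^-1` A) = T @^-1` (@cons_rV R n @^-1` A)); last first.
  by apply/seteqP; split => p /=; rewrite consT.
rewrite [RHS](product_measure_unique (m' := nu))// => B C mB mC.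
transitivity (lebesgue_measure (S @^-1` B) *
    lebesgue_measure_rV ((fun t : 'rV[R]_n => (a' - t)%R) @^-1` C))%E.
  apply: product_measure1E.
    by rewrite -[X in measurable X]setTI; exact: mS.
  by rewrite -[X in measurable X]setTI; exact: measurable_reflect.
by congr (_ * _)%E; [exact: lebesgue_measure_reflect1|exact: IHn].
Qed.

End rV_measure.

(** * Integrals of continuous functions over bounded sets; Euclidean balls *)

Section bounded_integrals.
Set Implicit Arguments.
Unset Strict Implicit.
Unset Printing Implicit Defensive.
Context {R : realType}.
Implicit Types n : nat.
Local Notation mu := lebesgue_measure_rV.

Lemma continuous_bounded_cube n (f : 'rV[R]_n -> R) x r : continuous f -> 0 <= r ->
  exists2 G, 0 <= G & forall t, `|t - x| <= r -> `|f t| <= G.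
Proof.
move=> cf r0.
have cK : compact [set t : 'rV[R]_n | `|t - x| <= r].
  rewrite closed_cube_itv//.
  apply: (@rV_compact _ _ (fun i => `[x ord0 i - r, x ord0 i + r]%classic)).
  by move=> i; exact: segment_compact.
have K0 : [set t : 'rV[R]_n | `|t - x| <= r] !=set0.
  by exists x; rewrite /= subrr normr0.
have cnf : {within [set t : 'rV[R]_n | `|t - x| <= r], continuous (fun t => `|f t|)}.
  apply: continuous_subspaceT => t.
  by apply: continuous_comp; [exact: cf|exact: norm_continuous].
have [c _ cP] := EVT_max_rV K0 cK cnf.
by exists `|f c| => // t tx; apply: cP; rewrite inE.
Qed.

Lemma integrable_in_cube n (f : 'rV[R]_n -> R) (A : set 'rV[R]_n) x r :
  continuous f -> 0 <= r -> measurable A -> A `<=` [set t | `|t - x| <= r] ->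
  mu.-integrable A (EFin \o f).
Proof.
move=> cf r0 mA Ar.
apply: (@integrableS _ _ _ _ [set t | `|t - x| <= r]) => //.
  exact: measurable_cube.
have [G G0 fG] := continuous_bounded_cube x cf r0.
apply: measurable_bounded_integrable.
- exact: measurable_cube.
- exact: cube_lty.
- by apply: measurable_funTS; exact: continuous_measurable_rV.
- exists G; split => //; first exact: ger0_real.
  by move=> M GM t /= tx; apply: le_trans (fG _ tx) (ltW GM).
Qed.

Lemma Rintegral_cube n (f : 'rV[R]_n -> R) x r :
  (forall t, r < `|t - x| -> f t = 0) ->
  \int[mu]_t f t = \int[mu]_(t in [set t | `|t - x| <= r]) f t.
Proof.
move=> f0; rewrite [RHS]Rintegral_mkcond; apply: eq_Rintegral => t _.
rewrite patchE; case: ifPn => //; rewrite notin_setE/= => /negP.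
by rewrite -ltNge => /f0.
Qed.

Lemma csupp_integrable n (f : 'rV[R]_n -> R) x r : continuous f -> 0 <= r ->
  (forall t, r < `|t - x| -> f t = 0) -> mu.-integrable setT (EFin \o f).
Proof.
move=> cf r0 f0.
have := @integrable_in_cube n f _ x r cf r0 (measurable_cube x r0) (@subset_refl _ _).
rewrite integrable_mkcond//; last exact: measurable_cube.
apply: eq_integrable => // t _ /=; rewrite patchE; case: ifPn => //.
by rewrite notin_setE/= => /negP; rewrite -ltNge => /f0 ->.
Qed.

Lemma Rintegral_reflect n (a : 'rV[R]_n) (D : set 'rV[R]_n) f :
  measurable D -> measurable_fun setT f ->
  mu.-integrable ((fun t => a - t) @^-1` D) (EFin \o (fun t => f (a - t))) ->
  \int[mu]_(t in D) f t = \int[mu]_(t in (fun t => a - t) @^-1` D) f (a - t).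
Proof.
move=> mD mf intf; congr fine.
have mr := measurable_reflect a.
rewrite -(@integral_pushforward _ _ _ _ _ _ mr mu D (EFin \o f))//; last first.
  exact/measurable_EFinP.
apply: (@eq_measure_integral _ _ _ _
  (measure_function_pushforward__canonical__measure_function_Measure mu mr)) => A mA _.
exact/esym/lebesgue_measure_reflect.
Qed.

Definition sqnorm n (x : 'rV[R]_n) : R := \sum_(i < n) x ord0 i ^+ 2.

Lemma sqnorm_ge0 n (x : 'rV[R]_n) : 0 <= sqnorm x.
Proof. by apply: sumr_ge0 => i _; exact: sqr_ge0. Qed.

Lemma sqnormN n (x : 'rV[R]_n) : sqnorm (- x) = sqnorm x.
Proof. by apply: eq_bigr => i _; rewrite mxE sqrrN. Qed.

Lemma sqr_coord_le n (x : 'rV[R]_n) i : x ord0 i ^+ 2 <= sqnorm x.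
Proof.
rewrite /sqnorm (bigD1 i)//= lerDl; apply: sumr_ge0 => j _; exact: sqr_ge0.
Qed.

Lemma sqr_norm_le n (x : 'rV[R]_n) : `|x| ^+ 2 <= sqnorm x.
Proof.
rewrite -[leRHS]sqr_sqrtr ?sqnorm_ge0// ler_sqr ?nnegrE ?sqrtr_ge0//.
apply: norm_rV_le; first exact: sqrtr_ge0.
by move=> i; rewrite -sqrtr_sqr ler_wsqrtr// sqr_coord_le.
Qed.

Lemma sqnorm_le n (x : 'rV[R]_n) : sqnorm x <= n%:R * `|x| ^+ 2.
Proof.
apply: (@le_trans _ _ (\sum_(i < n) `|x| ^+ 2)).
  apply: ler_sum => i _; rewrite -real_normK ?num_real//.
  by rewrite ler_sqr ?nnegrE// coord_le_norm.
by rewrite sumr_const card_ord mulr_natl.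
Qed.

Lemma continuous_sumr (T : topologicalType) (I : Type) (s : seq I) (f : I -> T -> R) :
  (forall i, continuous (f i)) -> continuous (fun x => \sum_(i <- s) f i x).
Proof.
move=> cf; rewrite -fct_sumE; apply: (big_ind (fun h : T -> R => continuous h)) => //.
  exact: cst_continuous.
by move=> h k ch ck t; apply: cvgD; [exact: ch|exact: ck].
Qed.

Lemma continuous_mulr (T : topologicalType) (f g : T -> R) :
  continuous f -> continuous g -> continuous (fun x => f x * g x).
Proof. by move=> cf cg x; apply: cvgM; [exact: cf|exact: cg]. Qed.

Lemma continuous_subr (T : topologicalType) (f g : T -> R) :
  continuous f -> continuous g -> continuous (fun x => f x - g x).
Proof. by move=> cf cg x; apply: cvgB; [exact: cf|exact: cg]. Qed.

Lemma continuous_oppr (T : topologicalType) (f : T -> R) :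
  continuous f -> continuous (fun x => - f x).
Proof. by move=> cf x; apply: cvgN; exact: cf. Qed.

Lemma sqnorm_continuous n : continuous (@sqnorm n).
Proof.
apply: continuous_sumr => i x.
apply: (@continuous_comp _ _ _ (fun y : 'rV[R]_n => y ord0 i) (fun t => t ^+ 2)).
  exact: coord_continuous.
exact: exprn_continuous.
Qed.

Lemma euclidean_ballE n (x : 'rV[R]_n) h : 0 < h ->
  euclidean_ball x h = [set t | sqnorm (t - x) < h ^+ 2].
Proof.
move=> h0; apply/seteqP; split => t; rewrite /euclidean_ball/= /euclidean_norm.
  rewrite -/(sqnorm _) => H.
  by rewrite -(ltr_sqrt _ (exprn_gt0 2 h0)) sqrtr_sqr gtr0_norm.
by move=> H; rewrite -/(sqnorm _) -[ltRHS]gtr0_norm// -sqrtr_sqr ltr_sqrt// exprn_gt0.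
Qed.

Lemma measurable_euclidean_ball n (x : 'rV[R]_n) h : 0 < h ->
  measurable (euclidean_ball x h).
Proof.
move=> h0; rewrite euclidean_ballE//.
apply: open_measurable_rV.
have := @open_comp _ _ (fun t : 'rV[R]_n => sqnorm (t - x)) [set y : R | y < h ^+ 2].
apply; last exact: open_lt.
move=> t _; apply: continuous_comp; last exact: sqnorm_continuous.
by apply: continuousB; [exact: cvg_id|exact: cst_continuous].
Qed.

Lemma euclidean_ball_sub n (x : 'rV[R]_n) h : 0 < h ->
  euclidean_ball x h `<=` [set t | `|t - x| <= h].
Proof.
move=> h0; rewrite euclidean_ballE// => t /= H.
by have := le_trans (sqr_norm_le _) (ltW H); rewrite ler_sqr// nnegrE// ltW.
Qed.

Lemma euclidean_ball_fin_num n (x : 'rV[R]_n) h : 0 < h ->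
  mu (euclidean_ball x h) \is a fin_num.
Proof.
move=> h0; rewrite ge0_fin_numE ?measure_ge0//.
apply: le_lt_trans (cube_lty x (ltW h0)).
apply: le_measure; rewrite ?inE; first exact: measurable_euclidean_ball.
  exact: measurable_cube (ltW h0).
exact: euclidean_ball_sub.
Qed.

Lemma euclidean_ball_gt0 n (x : 'rV[R]_n) h : 0 < h ->
  0 < fine (mu (euclidean_ball x h)).
Proof.
(* The cube of half-side [e] lies in the ball as soon as [n e^2 < h^2]; the denominator
   [n + 1] achieves this and is nonzero in dimension 0 as well. *)
move=> h0; set e := h / n.+1%:R.
have e0 : 0 < e by rewrite divr_gt0.
have : [set t | `|t - x| <= e] `<=` euclidean_ball x h.
  rewrite euclidean_ballE// => t /= te.
  apply: le_lt_trans (sqnorm_le _) _.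
  apply: (@le_lt_trans _ _ (n%:R * e ^+ 2)).
    by rewrite ler_wpM2l// ler_sqr ?nnegrE// ltW.
  rewrite /e expr_div_n mulrA ltr_pdivrMr ?exprn_gt0// mulrC.
  rewrite ltr_pM2l ?exprn_gt0// -natrX ltr_nat.
  by rewrite expnS expn1 mulSn ltnS leq_addr.
move=> sub; apply: fine_gt0; apply/andP; split; last first.
  by rewrite -ge0_fin_numE ?measure_ge0// euclidean_ball_fin_num.
apply: lt_le_trans (le_measure _ _ _ sub); rewrite ?inE; last 2 first.
  exact: measurable_cube (ltW _).
  exact: measurable_euclidean_ball.
pose A i := `[x ord0 i - e, x ord0 i + e]%classic.
rewrite closed_cube_itv ?ltW// [ltRHS](lebesgue_measure_rV_box (A := A)); last first.
  by move=> i; exact: measurable_itv.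
apply: (big_ind (fun y => 0 < y)%E) => // [y z|i _]; first exact: mule_gt0.
by rewrite /A lebesgue_measure_itv/= lte_fin ltrD2l gtrN// -EFinB lte_fin; lra.
Qed.

End bounded_integrals.

(** * Differentiability of convolutions *)

Section convolution.
Set Implicit Arguments.
Unset Strict Implicit.
Unset Printing Implicit Defensive.
Context {R : realType}.
Implicit Types n : nat.
Local Notation mu := lebesgue_measure_rV.

Lemma differentiable_linear_approx (V W : normedModType R) (f : V -> W)
    (L : {linear V -> W}) x C : continuous L ->
  (forall z, `|z| <= 1 -> `|f (z + x) - f x - L z| <= C * `|z| ^+ 2) ->
  differentiable f x /\ 'd f x = L :> (V -> W).
Proof.
move=> cL fC.
have fL : f \o shift x = cst (f x) + L +o_ 0 id.
  apply/eqaddoP => e e0; near=> z.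
  rewrite -[(_ - _) z]/(f (z + x) - (f x + L z)) opprD addrA.
  apply: le_trans (fC z _) _; first by near: z; exact: nbhs0_le.
  rewrite expr2 mulrA ler_wpM2r//.
  apply: (@le_trans _ _ ((`|C| + 1) * `|z|)).
    by rewrite ler_wpM2r// (le_trans (ler_norm _))// lerDl.
  rewrite mulrC -ler_pdivlMr ?ltr_wpDl//.
  by near: z; apply: nbhs0_le; rewrite divr_gt0 ?ltr_wpDl.
have dL := diff_unique cL fL.
by split => //; apply/diff_locallyP; rewrite dL.
Unshelve. all: by end_near. Qed.

Lemma differentiable_of_quadratic_remainder n (f : 'rV[R]_n -> R) (a : 'I_n -> R) x C :
  (forall z, `|z| <= 1 ->
    `|f (z + x) - f x - \sum_(j < n) z ord0 j * a j| <= C * `|z| ^+ 2) ->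
  differentiable f x /\ forall j, partial j f x = a j.
Proof.
move=> fC; pose l (z : 'rV[R]_n) := \sum_(j < n) z ord0 j * a j.
have l_lin : linear l.
  move=> k u w; rewrite /l scaler_sumr -big_split/=; apply: eq_bigr => j _.
  by rewrite !mxE mulrDl -mulrA.
pose lM := GRing.isLinear.Build _ _ _ _ _ l_lin.
pose L : {linear 'rV[R]_n -> R} := HB.pack l lM.
have cL : continuous L.
  apply: continuous_sumr => j; apply: continuous_mulr; last exact: cst_continuous.
  exact: coord_continuous.
have [df dL] := differentiable_linear_approx cL fC.
split => // j; rewrite /partial deriveE// dL /= /l (bigD1 j)//= big1 ?addr0.
  by rewrite mxE !eqxx mul1r.
by move=> i ij; rewrite mxE (negbTE ij) andbF mul0r.
Qed.

Definition conv n (K g : 'rV[R]_n -> R) (x : 'rV[R]_n) : R :=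
  \int[mu]_t (K (t - x) * g t).

Lemma continuous_comp_shift n (K : 'rV[R]_n -> R) (x : 'rV[R]_n) : continuous K ->
  continuous (fun t : 'rV[R]_n => K (t - x)).
Proof.
move=> cK t; apply: continuous_comp; last exact: cK.
by apply: continuousB; [exact: cvg_id|exact: cst_continuous].
Qed.

Lemma conv_integrable n (K g : 'rV[R]_n -> R) (x : 'rV[R]_n) :
  continuous K -> (forall y, 1 < `|y| -> K y = 0) -> continuous g ->
  mu.-integrable setT (EFin \o (fun t => K (t - x) * g t)).
Proof.
move=> cK K0 cg; apply: (@csupp_integrable _ _ _ x 1) => //.
  by apply: continuous_mulr => //; exact: continuous_comp_shift.
by move=> t /K0 ->; rewrite mul0r.
Qed.

Section integrable_real.
Context d (T : measurableType d) (m : {measure set T -> \bar R}).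
Variables (D : set T) (mD : measurable D).

Lemma integrable_mulrl (k : R) (f : T -> R) : m.-integrable D (EFin \o f) ->
  m.-integrable D (EFin \o (fun x => k * f x)).
Proof. exact: (@integrableZl _ _ _ m D mD k (EFin \o f)). Qed.

Lemma integrable_subr (f g : T -> R) :
  m.-integrable D (EFin \o f) -> m.-integrable D (EFin \o g) ->
  m.-integrable D (EFin \o (fun x => f x - g x)).
Proof. exact: (@integrableB _ _ _ m D mD (EFin \o f) (EFin \o g)). Qed.

Lemma integrable_sumr (I : Type) (s : seq I) (f : I -> T -> R) :
  (forall i, m.-integrable D (EFin \o f i)) ->
  m.-integrable D (EFin \o (fun x => \sum_(i <- s) f i x)).
Proof.
move=> intf; rewrite (_ : _ \o _ = (fun x => \sum_(i <- s) (EFin \o f i) x)%E).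
  exact: integrable_sum.
by apply/funext => x /=; rewrite sumEFin.
Qed.

Lemma Rintegral_sum (I : Type) (s : seq I) (f : I -> T -> R) :
  (forall i, m.-integrable D (EFin \o f i)) ->
  \int[m]_(x in D) (\sum_(i <- s) f i x) = \sum_(i <- s) \int[m]_(x in D) f i x.
Proof.
move=> intf; elim: s => [|i s IH].
  rewrite big_nil; under eq_Rintegral do rewrite big_nil.
  by rewrite Rintegral_cst// mul0r.
rewrite big_cons -IH -RintegralD//; last exact: integrable_sumr.
by apply: eq_Rintegral => x _; rewrite big_cons.
Qed.

End integrable_real.

(** Differentiation under the integral sign without dominated convergence: since the
    remainder of [K] is at most [M |z|^2] uniformly, integrating it against [g] over a
    cube outside of which everything vanishes leaves an error of order [|z|^2].  The
    sign comes from [K (t - x)] being differentiated in [x].  The estimate is asked for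
    [|y| <= 2] and [|z| <= 1] because the supports lie in [|y| <= 1]: beyond, all the
    terms vanish. *)
Lemma conv_differentiable n (K : 'rV[R]_n -> R) (D : 'I_n -> 'rV[R]_n -> R) M g :
  continuous K -> (forall j, continuous (D j)) ->
  (forall y, 1 < `|y| -> K y = 0) ->
  (forall j y, 1 < `|y| -> D j y = 0) ->
  (forall y z, `|y| <= 2 -> `|z| <= 1 ->
    `|K (y + z) - K y - \sum_(j < n) z ord0 j * D j y| <= M * `|z| ^+ 2) ->
  continuous g ->
  forall x, differentiable (conv K g) x /\
    forall j, partial j (conv K g) x = - conv (D j) g x.
Proof.
move=> cK cD K0 D0 KM cg x.
have [G G0 gG] := continuous_bounded_cube x cg (@ler0n R 2).
have mQ := measurable_cube x (@ler0n R 2).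
apply: (@differentiable_of_quadratic_remainder _ _ _ _
  (`|M| * G * fine (mu [set t | `|t - x| <= 2%:R]))).
move=> z z1.
pose F t := (K (t - (z + x)) - K (t - x)
  - \sum_(j < n) (- z) ord0 j * D j (t - x)) * g t.
have iK := conv_integrable _ cK K0 cg.
have iD j := conv_integrable x (cD j) (D0 j) cg.
have iS : mu.-integrable setT (EFin \o (fun t =>
    \sum_(j < n) (- z) ord0 j * (D j (t - x) * g t))).
  apply: integrable_sumr => // j.
  by apply: integrable_mulrl => //; exact: iD.
have -> : conv K g (z + x) - conv K g x
    - \sum_(j < n) z ord0 j * - conv (D j) g x = \int[mu]_t F t.
  transitivity (conv K g (z + x) - conv K g x
    - \int[mu]_t (\sum_(j < n) (- z) ord0 j * (D j (t - x) * g t))).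
    congr (_ - _); rewrite Rintegral_sum//; last first.
      by move=> j; apply: integrable_mulrl => //; exact: iD.
    apply: eq_bigr => j _; rewrite RintegralZl//.
    by rewrite !mxE mulrN mulNr.
  rewrite /conv -RintegralB//.
  rewrite -RintegralB//; last exact: integrable_subr.
  apply: eq_Rintegral => t _; rewrite /F !mulrBl mulr_suml.
  by under [in RHS]eq_bigr do rewrite -mulrA.
have F0 t : 2 < `|t - x| -> F t = 0.
  move=> t2; rewrite /F K0; last first.
    rewrite opprD addrCA addrC; apply: lt_le_trans (lerB_normD _ _).
    by rewrite normrN; lra.
  rewrite K0 ?(lt_trans _ t2) ?ltr1n// big1 ?subr0 ?mul0r// => j _.
  by rewrite D0 ?mulr0// (lt_trans _ t2) ?ltr1n.
have cF : continuous F.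
  apply: continuous_mulr => //; apply: continuous_subr.
    by apply: continuous_subr; exact: continuous_comp_shift.
  apply: continuous_sumr => j; apply: continuous_mulr; first exact: cst_continuous.
  exact: continuous_comp_shift.
rewrite (Rintegral_cube F0).
have iF : mu.-integrable [set t | `|t - x| <= 2] (EFin \o F).
  exact: (integrable_in_cube cF (ler0n _ 2) mQ (@subset_refl _ _)).
apply: le_trans (le_normr_Rintegral mQ iF) _.
rewrite mulrAC [X in X * _]mulrAC -(Rintegral_cst mu mQ).
apply: le_Rintegral => //.
- exact: integrable_norm.
- exact: (integrable_in_cube (@cst_continuous _ _ _) (ler0n _ 2) mQ (@subset_refl _ _)).
move=> t /= t2; rewrite /F normrM.
apply: ler_pM => //; last exact: gG.
have := KM (t - x) (- z) t2; rewrite normrN => /(_ z1).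
rewrite (_ : t - x - z = t - (z + x)); last by rewrite opprD addrA addrAC.
by move/le_trans; apply; rewrite ler_wpM2r// ?ler_norm.
Qed.

End convolution.

(** * Shifted ball means and derivatives *)

Section shifted_means.
Set Implicit Arguments.
Unset Strict Implicit.
Unset Printing Implicit Defensive.
Context {R : realType}.
Implicit Types n : nat.
Local Notation mu := lebesgue_measure_rV.

Lemma integrable_euclidean_ball n (f : 'rV[R]_n -> R) (x : 'rV[R]_n) h :
  0 < h -> continuous f -> mu.-integrable (euclidean_ball x h) (EFin \o f).
Proof.
move=> h0 cf; apply: (integrable_in_cube cf (ltW h0)).
  exact: measurable_euclidean_ball.
exact: euclidean_ball_sub.
Qed.

Lemma ball_meanE n (g : 'rV[R]_n -> R) (x : 'rV[R]_n) h : 0 < h ->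
  ball_mean g x h * fine (mu (euclidean_ball x h)) =
  \int[mu]_(t in euclidean_ball x h) g t.
Proof.
by move=> h0; rewrite /ball_mean mulrC mulVKf// gt_eqF// euclidean_ball_gt0.
Qed.

(** The reflection [t |-> 2 x - t] preserves the ball and changes the sign of the
    integrand. *)
Lemma Rintegral_odd_ball n (l : 'rV[R]_n -> R) (x : 'rV[R]_n) h : 0 < h ->
  continuous l -> (forall y, l (- y) = - l y) ->
  \int[mu]_(t in euclidean_ball x h) l (t - x) = 0.
Proof.
move=> h0 cl oddl; set I := LHS.
have cs : continuous (fun t : 'rV[R]_n => l (t - x)) by exact: continuous_comp_shift.
have mB := measurable_euclidean_ball x h0.
have reflE (t : 'rV[R]_n) : x + x - t - x = - (t - x).
  by rewrite opprB addrAC addrK.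
have reflB : (fun t : 'rV[R]_n => (x + x) - t) @^-1` euclidean_ball x h
    = euclidean_ball x h.
  by apply/seteqP; split => t; rewrite !euclidean_ballE//= reflE sqnormN.
have refll (t : 'rV[R]_n) : l (x + x - t - x) = - l (t - x).
  by rewrite reflE oddl.
have IN : I = - I.
  rewrite {1}/I (@Rintegral_reflect _ _ (x + x) _ (fun t => l (t - x)))//.
  - rewrite reflB; under eq_Rintegral do rewrite refll -mulN1r.
    by rewrite RintegralZl// ?mulN1r//; exact: integrable_euclidean_ball.
  - exact: continuous_measurable_rV.
  - rewrite reflB; under eq_fun do rewrite refll.
    by apply: integrable_euclidean_ball => //; exact: continuous_oppr.
by move: IN; lra.
Qed.

(** The mean over the ball of radius [h] is [g x + o(h)] because the linear term
    averages to zero, so [c h l v = o(h)]. *)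
Lemma derive_eq0_of_shifted_mean n (g : 'rV[R]_n -> R) (x v : 'rV[R]_n) c :
  continuous g -> differentiable g x -> c != 0 ->
  (forall h, 0 < h -> g (x + (c * h) *: v) = ball_mean g x h) ->
  'D_v g x = 0.
Proof.
move=> cg dg c0 gm; rewrite deriveE//; set l := 'd g x.
have cl : continuous l by exact: diff_continuous.
apply/eqP; rewrite -normr_le0 leNgt; apply/negP => lv0.
have cv0 : 0 < `|c| * `|l v| by rewrite mulr_gt0// normr_gt0.
pose C := `|c| * `|v|; have C0 : 0 <= C by rewrite mulr_ge0.
(* With error level [e] the two expansions give [|c| |l v| <= e (C + 1)], which is
   half of [|c| |l v|] for this [e]; [h] is such that both the ball and the shift
   [c h v], of norm [C h], stay within the distance [d] where the expansion holds. *)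
pose e := `|c| * `|l v| / (2 * (C + 1)).
have e0 : 0 < e by rewrite divr_gt0// mulr_gt0// ltr_wpDl.
have [d d0 dP] : exists2 d, 0 < d & forall z, `|z| < d ->
    `|g (x + z) - g x - l z| <= e * `|z|.
  have /eqaddoP/(_ e e0) := diff_locally dg.
  move=> /nbhs_ballP[d /= d0 dP]; exists d => // z zd.
  have := dP z; rewrite -ball_normE/= sub0r normrN => /(_ zd).
  rewrite -[(_ - _) z]/(g (z + x) - (g x + l z)) (addrC z).
  by rewrite opprD addrA.
pose h := d / (2 * (C + 1)).
have C10 : 0 < 2 * (C + 1) by lra.
have h0 : 0 < h by rewrite divr_gt0.
have hE : h * (2 * (C + 1)) = d by rewrite divfK// gt_eqF.
have Ch0 : 0 <= C * h by rewrite mulr_ge0// ltW.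
have hd : h < d by nra.
have Chd : C * h < d by nra.
have eE : e * (2 * (C + 1)) = `|c| * `|l v| by rewrite divfK// gt_eqF.
have mB := measurable_euclidean_ball x h0.
have V0 := euclidean_ball_gt0 x h0.
have iB f (cf : continuous f) := @integrable_euclidean_ball n f x h h0 cf.
set V := fine _ in V0.
have cgx : continuous (fun t => g t - g x).
  by apply: continuous_subr => //; exact: cst_continuous.
have cs : continuous (fun t : 'rV[R]_n => l (t - x)) by exact: continuous_comp_shift.
have mean_dev : (g (x + (c * h) *: v) - g x) * V =
    \int[mu]_(t in euclidean_ball x h) (g t - g x - l (t - x)).
  rewrite RintegralB//; [|exact: iB|exact: iB].
  rewrite (Rintegral_odd_ball x h0 cl) ?subr0; last by move=> y; rewrite linearN.
  rewrite RintegralB//; [|exact: iB|by apply: iB; exact: cst_continuous].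
  by rewrite Rintegral_cst// mulrBl gm// ball_meanE.
have dev_le : `|g (x + (c * h) *: v) - g x| <= e * h.
  rewrite -(ler_pM2r V0) -[X in _ * X <= _]gtr0_norm// -normrM mean_dev.
  apply: le_trans (le_normr_Rintegral mB _) _.
    by apply: iB; exact: continuous_subr.
  rewrite /V -(Rintegral_cst mu mB); apply: le_Rintegral => //.
  - by apply: integrable_norm; apply: iB; exact: continuous_subr.
  - by apply: iB; exact: cst_continuous.
  move=> t /euclidean_ball_sub -/(_ h0)/= th.
  have := dP (t - x) (le_lt_trans th hd); rewrite (addrC x) subrK => /le_trans; apply.
  by rewrite ler_wpM2l// ltW.
have nchv : `|(c * h) *: v| = C * h.
  by rewrite normrZ normrM (gtr0_norm h0) /C; ring.
have := dP ((c * h) *: v); rewrite nchv => /(_ Chd).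
rewrite linearZ/= => lin_le.
have : `|(c * h) *: l v| <= e * h + e * (C * h).
  rewrite -[X in `|X|](subKr (g (x + (c * h) *: v) - g x)).
  by apply: le_trans (ler_normB _ _) _; exact: lerD.
rewrite normrZ normrM (gtr0_norm h0) => fin.
have : `|c| * `|l v| * h <= e * (C + 1) * h by lra.
rewrite ler_pM2r//; lra.
Qed.

Lemma derive_eq0_translate n (g : 'rV[R]_n -> R) (v : 'rV[R]_n) :
  (forall x, differentiable g x) -> (forall x, 'D_v g x = 0) ->
  forall x s, g (x + s *: v) = g x.
Proof.
move=> dg Dv0 x s; pose f (r : R) := g (x + r *: v).
rewrite -[LHS]/(f s) (_ : g x = f 0); last by rewrite /f scale0r addr0.
apply: is_derive_0_is_cst => r.
have E : (fun h : R => h^-1 *: ((f \o shift r) (h *: (1 : R)) - f r)) =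
    (fun h => h^-1 *: ((g \o shift (x + r *: v)) (h *: v) - g (x + r *: v))).
  apply/funext => h /=; rewrite /f; congr (_ *: (g _ - _)).
  by rewrite [_%:A]mulr1 scalerDl addrCA.
apply: DeriveDef.
  by rewrite /derivable E; exact: diff_derivable.
by rewrite /derive E; exact: Dv0.
Qed.

End shifted_means.

(** * Radially decreasing kernels reproduce functions with the mean value property *)

Section layer_cake.
Set Implicit Arguments.
Unset Strict Implicit.
Unset Printing Implicit Defensive.
Context {R : realType}.
Implicit Types n : nat.
Local Notation mu := lebesgue_measure_rV.

Definition mean_value_property n (g : 'rV[R]_n -> R) :=
  forall x h, 0 < h -> g x = ball_mean g x h.

(** Stated through superlevel sets because the kernel is going to be sliced along
    them. *)
Definition radially_decreasing n (K : 'rV[R]_n -> R) :=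
  forall s, 0 <= s -> (forall y, K y <= s) \/
    exists2 h, 0 < h & forall y, (s < K y) = (sqnorm y < h ^+ 2).

Section fix_kernel.
Variables (n : nat) (K : 'rV[R]_n -> R) (x : 'rV[R]_n).
Hypotheses (K_ge0 : forall y, 0 <= K y) (cK : continuous K)
  (K_supp : forall y, 1 < `|y| -> K y = 0).

(* The region under the graph of the kernel centred at [x]: its vertical sections have
   length [K (t - x)], its horizontal sections are superlevel sets of the kernel. *)
Let E : set (measurableTypeR R * 'rV[R]_n) :=
  [set p | (0 <= (p.1 : R)) && ((p.1 : R) < K (p.2 - x))].

Let mE : measurable E.
Proof.
have m1 : measurable_fun setT (fun p : measurableTypeR R * 'rV[R]_n => p.1 : R).
  exact: measurable_fst.
have m2 : measurable_fun setT (fun p : measurableTypeR R * 'rV[R]_n => K (p.2 - x)).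
  have mK : measurable_fun setT (fun t : 'rV[R]_n => K (t - x)).
    by apply: continuous_measurable_rV; exact: continuous_comp_shift.
  exact: (measurableT_comp mK measurable_snd).
have mb : measurable_fun setT (fun p : measurableTypeR R * 'rV[R]_n =>
    (0 <= (p.1 : R)) && ((p.1 : R) < K (p.2 - x))).
  apply: measurable_and; first exact: measurable_fun_ler.
  exact: measurable_fun_ltr.
by have := mb measurableT [set true] I; rewrite setTI.
Qed.

Let F (f : 'rV[R]_n -> R) (p : measurableTypeR R * 'rV[R]_n) : R :=
  \1_E p * f p.2.

Let mF f : continuous f -> measurable_fun setT (EFin \o F f).
Proof.
move=> cf; apply/measurable_EFinP; apply: measurable_funM.
  exact: measurable_indic.
by apply: measurableT_comp => //; exact: continuous_measurable_rV.
Qed.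

Let integral_level f t :
  (\int[lebesgue_measure]_s (F f (s, t))%:E = (K (t - x) * f t)%:E)%E.
Proof.
transitivity (\int[lebesgue_measure]_(s in `[0%R, K (t - x)[) (f t)%:E)%E.
  rewrite [RHS]integral_mkcond; apply: eq_integral => s _.
  rewrite patchE /F indicE /=.
  case: ifPn => [|]; rewrite ?notin_setE ?inE/= in_itv/= => H.
    by rewrite mem_set ?mul1r.
  by rewrite memNset ?mul0r.
rewrite integral_cst//= lebesgue_measure_itv/= lte_fin.
case: ifPn => [_|]; first by rewrite oppr0 adde0 -EFinM mulrC.
rewrite -leNgt => K0; have -> : K (t - x) = 0 by apply/eqP; rewrite eq_le K0 K_ge0.
by rewrite mule0 mul0r.
Qed.

Let integrable_F f : continuous f ->
  (lebesgue_measure \x mu)%E.-integrable setT (EFin \o F f).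
Proof.
move=> cf; apply/(integrable21ltyP _ _ (mF cf)).
have -> : (\int[mu]_t \int[lebesgue_measure]_s `|(EFin \o F f) (s, t)|
    = \int[mu]_t `|(K (t - x) * f t)%:E|)%E.
  apply: eq_integral => t _.
  rewrite /= normrM (ger0_norm (K_ge0 _)) -(integral_level (fun t => `|f t|)).
  by apply: eq_integral => s _; rewrite /F /= normrM indicE ger0_norm.
by have /integrableP[] := conv_integrable x cK K_supp cf.
Qed.

Let convE f : continuous f ->
  ((conv K f x)%:E = \int[lebesgue_measure]_s \int[mu]_t (F f (s, t))%:E)%E.
Proof.
move=> cf; rewrite (Fubini (integrable_F cf))/=.
rewrite /conv /Rintegral fineK.
  by apply: eq_integral => t _; rewrite integral_level.
by apply: integrable_fin_num => //; exact: conv_integrable.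
Qed.

Let integral_slice f s : (\int[mu]_t (F f (s, t))%:E =
  \int[mu]_(t in [set t | (0 <= s)%R && (s < K (t - x))%R]) (f t)%:E)%E.
Proof.
rewrite [RHS]integral_mkcond; apply: eq_integral => t _.
rewrite patchE /F indicE /=.
case: ifPn => [|]; rewrite ?notin_setE ?inE/= => H.
  by rewrite mem_set ?mul1r.
by rewrite memNset ?mul0r.
Qed.

(** Integrate [g] over the region under the graph of [K]: by vertical sections one gets
    [conv K g x].  Every nonempty horizontal section is a ball about [x], over which [g] and
    the constant [g x] have the same integral, so [g] may be replaced by that
    constant. *)
Lemma conv_mean_value g : radially_decreasing K -> continuous g ->
  mean_value_property g -> conv K g x = g x * conv K (cst 1) x.
Proof.
move=> radK cg mg.
have ccst a : continuous (cst a : 'rV[R]_n -> R) by exact: cst_continuous.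
have -> : g x * conv K (cst 1) x = conv K (cst (g x)) x.
  rewrite /conv -RintegralZl//; last exact: conv_integrable.
  by apply: eq_Rintegral => t _ /=; rewrite mulr1 mulrC.
suff : ((conv K g x)%:E = (conv K (cst (g x)) x)%:E)%E by case.
rewrite !convE//; apply: eq_integral => s _; rewrite !integral_slice.
have [s0|s0] := leP 0 s; last first.
  have -> : [set t : 'rV[R]_n | false && (s < K (t - x))] = set0.
    by apply/seteqP; split.
  by rewrite !integral_set0.
have [Ks|[h h0 Kh]] := radK s s0.
  have -> : [set t : 'rV[R]_n | true && (s < K (t - x))] = set0.
    by apply/seteqP; split => t //=; rewrite ltNge Ks.
  by rewrite !integral_set0.
have -> : [set t : 'rV[R]_n | true && (s < K (t - x))] = euclidean_ball x h.
  by rewrite euclidean_ballE//; apply/seteqP; split => t /=; rewrite Kh.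
have fineE f : continuous f -> (\int[mu]_(t in euclidean_ball x h) (f t)%:E
    = (\int[mu]_(t in euclidean_ball x h) f t)%:E)%E.
  move=> cf; rewrite /Rintegral fineK//; apply: integrable_fin_num => //.
    exact: measurable_euclidean_ball.
  exact: integrable_euclidean_ball.
rewrite !fineE//; congr (_%:E); rewrite -ball_meanE// -mg//.
by rewrite Rintegral_cst//; exact: measurable_euclidean_ball.
Qed.

End fix_kernel.

End layer_cake.

(** * The truncated paraboloid kernels and harmonicity *)

Section bump_kernels.
Set Implicit Arguments.
Unset Strict Implicit.
Unset Printing Implicit Defensive.
Context {R : realType}.
Implicit Types n : nat.
Local Notation mu := lebesgue_measure_rV.

(** The profile of the kernels as a function of [a = |y|^2], which keeps the kernels
    polynomial inside the unit ball. *)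
Definition cut (a : R) : R := Num.max 0 (1 - a).

Lemma cut_ge0 a : 0 <= cut a. Proof. by rewrite /cut le_max lexx. Qed.

Lemma cut_le1 a : 0 <= a -> cut a <= 1.
Proof. by move=> a0; rewrite /cut ge_max ler01 lerBlDr lerDl. Qed.

Lemma cut_eq0 a : 1 <= a -> cut a = 0.
Proof. by move=> a1; rewrite /cut max_l// subr_le0. Qed.

Lemma mul_cut a : a * cut a = cut a - cut a ^+ 2.
Proof. by rewrite /cut; case: (leP 0 (1 - a)) => ?; ring. Qed.

Lemma cut_lipschitz a b : `|cut b - cut a| <= `|b - a|.
Proof.
rewrite /cut ler_norml; case: (ger0P (b - a)) => ?;
  case: (leP 0 (1 - a)) => ?; case: (leP 0 (1 - b)) => ?;
  by apply/andP; split; lra.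
Qed.

Lemma cut_sqr_lipschitz a b : 0 <= a -> 0 <= b ->
  `|cut b ^+ 2 - cut a ^+ 2| <= 2 * `|b - a|.
Proof.
move=> a0 b0; rewrite subr_sqr normrM mulrC.
apply: ler_pM => //; last exact: cut_lipschitz.
rewrite ger0_norm ?addr_ge0 ?cut_ge0//.
by have := cut_le1 a0; have := cut_le1 b0; lra.
Qed.

(** From the exponent 2 on, the truncation at [a = 1] does not spoil the quadratic
    remainder: [cut ^+ 2] is continuously differentiable with derivative [- 2 cut],
    which is Lipschitz. *)
Lemma cut_sqr_taylor a b : 0 <= a -> 0 <= b ->
  `|cut b ^+ 2 - cut a ^+ 2 + 2 * cut a * (b - a)| <= 2 * (b - a) ^+ 2.
Proof.
move=> a0 b0; rewrite /cut.
case: (leP 0 (1 - a)) => ha; case: (leP 0 (1 - b)) => hb.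
- rewrite [X in `|X|](_ : _ = (b - a) ^+ 2); last by ring.
  by rewrite ger0_norm ?sqr_ge0//; have := sqr_ge0 (b - a); lra.
- have h0 : 0 <= (1 - a) * (b - 1) by rewrite mulr_ge0; lra.
  have h1 := sqr_ge0 (b - 1); have h2 := sqr_ge0 (b - a).
  by rewrite ler_norml; apply/andP; split; nra.
- rewrite [X in `|X|](_ : _ = (1 - b) ^+ 2); last by ring.
  by rewrite ger0_norm ?sqr_ge0//; nra.
- rewrite [X in `|X|](_ : _ = 0); last by ring.
  by rewrite normr0 mulr_ge0// sqr_ge0.
Qed.

Lemma cut_cube_taylor a b : 0 <= a -> 0 <= b ->
  `|cut b ^+ 3 - cut a ^+ 3 + 3 * cut a ^+ 2 * (b - a)| <= 3 * (b - a) ^+ 2.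
Proof.
move=> a0 b0; rewrite /cut.
have ab2 := sqr_ge0 (b - a); have a2 := sqr_ge0 (1 - a); have b2 := sqr_ge0 (1 - b).
case: (leP 0 (1 - a)) => ha; case: (leP 0 (1 - b)) => hb.
- rewrite [X in `|X|](_ : _ = (b - a) ^+ 2 * ((1 - b) + 2 * (1 - a))); last by ring.
  rewrite ger0_norm; last by apply: mulr_ge0 => //; lra.
  by rewrite mulrC ler_wpM2r//; lra.
- rewrite [X in `|X|](_ : _ = (1 - a) ^+ 2 * (3 * (b - a) - (1 - a))); last by ring.
  rewrite ger0_norm; last by apply: mulr_ge0 => //; lra.
  have h1 : (1 - a) ^+ 2 <= (b - a) ^+ 2 by rewrite ler_sqr ?nnegrE; lra.
  have h2 : (1 - a) ^+ 2 * (3 * (b - a) - (1 - a)) <= (1 - a) ^+ 2 * (3 * (b - a)).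
    by rewrite ler_wpM2l//; lra.
  have h3 : (1 - a) ^+ 2 * (3 * (b - a)) <= (1 - a) * ((b - a) * (3 * (b - a))).
    rewrite expr2 -mulrA; apply: ler_wpM2l => //; apply: ler_wpM2r; lra.
  have h4 : (1 - a) * ((b - a) * (3 * (b - a))) <= 3 * (b - a) ^+ 2.
    rewrite (_ : (b - a) * (3 * (b - a)) = 3 * (b - a) ^+ 2); last by ring.
    by rewrite ler_piMl ?mulr_ge0//; lra.
  by lra.
- rewrite [X in `|X|](_ : _ = (1 - b) ^+ 2 * (1 - b)); last by ring.
  rewrite ger0_norm; last exact: mulr_ge0.
  have h1 : (1 - b) ^+ 2 <= (b - a) ^+ 2.
    by rewrite -[leRHS]sqrrN ler_sqr ?nnegrE; lra.
  have h2 : (1 - b) ^+ 2 * (1 - b) <= (1 - b) ^+ 2 by rewrite ler_piMr//; lra.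
  by lra.
- rewrite [X in `|X|](_ : _ = 0); last by ring.
  by rewrite normr0 mulr_ge0.
Qed.

Definition dot n (y z : 'rV[R]_n) : R := \sum_(i < n) z ord0 i * y ord0 i.

Lemma sqnormD n (y z : 'rV[R]_n) : sqnorm (y + z) = sqnorm y + 2 * dot y z + sqnorm z.
Proof.
rewrite /sqnorm /dot mulr_sumr -!big_split/=; apply: eq_bigr => i _.
by rewrite mxE; ring.
Qed.

Lemma sqnorm_diff_le n (y z : 'rV[R]_n) : `|y| <= 2 -> `|z| <= 1 ->
  `|sqnorm (y + z) - sqnorm y| <= 5 * n%:R * `|z|.
Proof.
move=> y2 z1; rewrite sqnormD.
have -> : sqnorm y + 2 * dot y z + sqnorm z - sqnorm y = 2 * dot y z + sqnorm z by ring.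
apply: le_trans (ler_normD _ _) _.
rewrite (ger0_norm (sqnorm_ge0 z)) normrM (ger0_norm (ler0n _ 2)).
have h1 : `|dot y z| <= n%:R * (2 * `|z|).
  apply: le_trans (ler_norm_sum _ _ _) _.
  apply: (@le_trans _ _ (\sum_(i < n) 2 * `|z|)); last first.
    by rewrite sumr_const card_ord -[leLHS]mulr_natl.
  apply: ler_sum => i _; rewrite normrM mulrC.
  by apply: ler_pM => //; [exact: le_trans (coord_le_norm _ _) y2|exact: coord_le_norm].
have h2 : sqnorm z <= n%:R * `|z|.
  apply: le_trans (sqnorm_le z) _; rewrite ler_wpM2l// expr2.
  by rewrite ler_piMl.
by lra.
Qed.

Lemma sqnorm_diff_sqr_le n (y z : 'rV[R]_n) : `|y| <= 2 -> `|z| <= 1 ->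
  (sqnorm (y + z) - sqnorm y) ^+ 2 <= 25 * n%:R ^+ 2 * `|z| ^+ 2.
Proof.
move=> y2 z1; rewrite -(real_normK (num_real _)).
rewrite (_ : 25 * _ * _ = (5 * n%:R * `|z|) ^+ 2); last by ring.
rewrite ler_sqr ?nnegrE ?mulr_ge0//.
exact: sqnorm_diff_le.
Qed.

Definition bump n k (y : 'rV[R]_n) : R := cut (sqnorm y) ^+ k.

Lemma bump_ge0 n k (y : 'rV[R]_n) : 0 <= bump k y.
Proof. by rewrite exprn_ge0// cut_ge0. Qed.

Lemma bump_le1 n k (y : 'rV[R]_n) : bump k y <= 1.
Proof. by rewrite exprn_ile1 ?cut_ge0// cut_le1// sqnorm_ge0. Qed.

Lemma bump_supp n k (y : 'rV[R]_n) : 1 < `|y| -> bump k.+1 y = 0.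
Proof.
move=> y1; rewrite /bump cut_eq0 ?expr0n// (le_trans _ (sqr_norm_le y))//.
by rewrite expr_ge1// ltW.
Qed.

Lemma bump_continuous n k : continuous (@bump n k).
Proof.
have cc : continuous (fun y : 'rV[R]_n => cut (sqnorm y)).
  move=> y; apply: (@continuous_comp _ _ _ (@sqnorm R n) cut).
    exact: sqnorm_continuous.
  apply: continuous_max; first exact: cst_continuous.
  by apply: continuous_subr; [exact: cst_continuous|move=> ?; exact: cvg_id].
move=> y; apply: (@continuous_comp _ _ _
  (fun y : 'rV[R]_n => cut (sqnorm y)) (fun t => t ^+ k)).
  exact: cc.
exact: exprn_continuous.
Qed.

(** For [s = r^(k+1) < 1], [s < bump (k+1) y] means [r < 1 - |y|^2], a ball of radius
    [sqrt (1 - r)]. *)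
Lemma bump_radially_decreasing n k : radially_decreasing (@bump n k.+1).
Proof.
move=> s s0; have [s1|s1] := leP 1 s.
  by left => y; exact: le_trans (bump_le1 _ _) s1.
right; pose r := s `^ k.+1%:R^-1.
have r0 : 0 <= r by exact: powR_ge0.
have rk : r ^+ k.+1 = s by rewrite -powR_mulrn// -powRrM mulVf// powRr1.
have r1 : r < 1 by rewrite -(@ltr_pXn2r _ k.+1)// ?nnegrE// rk expr1n.
exists (Num.sqrt (1 - r)) => [|y]; first by rewrite sqrtr_gt0 subr_gt0.
rewrite sqr_sqrtr ?subr_ge0 ?ltW// -rk /bump ltr_pXn2r// ?nnegrE// ?cut_ge0//.
rewrite /cut lt_max ltNge r0/=; apply/idP/idP; lra.
Qed.

(** By the chain rule through [|y + z|^2 = |y|^2 + 2 y.z + |z|^2]: the Taylor remainder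
    of [cut ^+ 3] is quadratic in [|y + z|^2 - |y|^2], itself at most [5 n |z|], and
    the term [|z|^2] that is left over is quadratic already. *)
Lemma bump3_taylor n (y z : 'rV[R]_n) : `|y| <= 2 -> `|z| <= 1 ->
  `|bump 3 (y + z) - bump 3 y
    - \sum_(j < n) z ord0 j * (- 6 * (y ord0 j * bump 2 y))|
  <= (75 * n%:R ^+ 2 + 3 * n%:R) * `|z| ^+ 2.
Proof.
move=> y2 z1.
have -> : \sum_(j < n) z ord0 j * (- 6 * (y ord0 j * bump 2 y))
    = - 6 * bump 2 y * dot y z.
  by rewrite /dot mulr_sumr; apply: eq_bigr => i _; ring.
rewrite /bump; set a := sqnorm y; set b := sqnorm (y + z).
have ba : 2 * dot y z = b - a - sqnorm z by rewrite /b sqnormD -/a; ring.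
have -> : cut b ^+ 3 - cut a ^+ 3 - - 6 * cut a ^+ 2 * dot y z =
    (cut b ^+ 3 - cut a ^+ 3 + 3 * cut a ^+ 2 * (b - a))
    - 3 * cut a ^+ 2 * sqnorm z.
  rewrite (_ : 6 = 3 * 2 :> R); last by ring.
  rewrite -[X in _ = _ + _ * (X) - _](_ : 2 * dot y z + sqnorm z = _); last first.
    by rewrite ba; ring.
  by ring.
have a0 : 0 <= a by exact: sqnorm_ge0.
have b0 : 0 <= b by exact: sqnorm_ge0.
apply: le_trans (ler_normB _ _) _.
rewrite [leRHS]mulrDl; apply: lerD.
  apply: le_trans (cut_cube_taylor a0 b0) _.
  by have := sqnorm_diff_sqr_le y2 z1; rewrite -/a -/b; lra.
have c1 : cut a ^+ 2 <= 1 by rewrite exprn_ile1 ?cut_ge0 ?cut_le1.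
rewrite ger0_norm; last by rewrite !mulr_ge0 ?sqnorm_ge0 ?cut_ge0.
have := sqnorm_le z.
by have := ler_piMl (sqnorm_ge0 z) c1; lra.
Qed.

(** The [j]-th partial derivative of [y |-> y_i bump 2 y]. *)
Definition coord_bump2_partial n (i j : 'I_n) (y : 'rV[R]_n) : R :=
  (i == j)%:R * bump 2 y - 4 * (y ord0 i * y ord0 j * bump 1 y).

(** Product rule: besides [y_i] times the remainder of [bump 2], there appear [z_i]
    times an increment of [bump 2] and the left-over [|z|^2]; both are quadratic in
    [z]. *)
Lemma coord_bump2_taylor n (i : 'I_n) (y z : 'rV[R]_n) : `|y| <= 2 -> `|z| <= 1 ->
  `|(y + z) ord0 i * bump 2 (y + z) - y ord0 i * bump 2 y
    - \sum_(j < n) z ord0 j * coord_bump2_partial i j y|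
  <= (100 * n%:R ^+ 2 + 14 * n%:R) * `|z| ^+ 2.
Proof.
move=> y2 z1.
have -> : \sum_(j < n) z ord0 j * coord_bump2_partial i j y
    = z ord0 i * bump 2 y - 4 * y ord0 i * bump 1 y * dot y z.
  transitivity (\sum_(j < n) (z ord0 j * (i == j)%:R * bump 2 y
      - 4 * y ord0 i * bump 1 y * (z ord0 j * y ord0 j))).
    by apply: eq_bigr => j _; rewrite /coord_bump2_partial; ring.
  rewrite sumrB -mulr_sumr -mulr_suml; congr (_ * _ - _).
  rewrite (bigD1 i)//= eqxx mulr1 big1 ?addr0// => j ij.
  by rewrite eq_sym (negbTE ij) mulr0.
rewrite mxE /bump expr1; set a := sqnorm y; set b := sqnorm (y + z).
have ba : dot y z = (b - a - sqnorm z) / 2 by rewrite /b sqnormD -/a; field.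
have -> : (y ord0 i + z ord0 i) * cut b ^+ 2 - y ord0 i * cut a ^+ 2
    - (z ord0 i * cut a ^+ 2 - 4 * y ord0 i * cut a * dot y z) =
    y ord0 i * (cut b ^+ 2 - cut a ^+ 2 + 2 * cut a * (b - a))
    + (z ord0 i * (cut b ^+ 2 - cut a ^+ 2) - y ord0 i * (2 * cut a * sqnorm z)).
  by rewrite ba; field.
have a0 : 0 <= a by exact: sqnorm_ge0.
have b0 : 0 <= b by exact: sqnorm_ge0.
have yi : `|y ord0 i| <= 2 by exact: le_trans (coord_le_norm _ _) y2.
have h1 : `|y ord0 i * (cut b ^+ 2 - cut a ^+ 2 + 2 * cut a * (b - a))|
    <= 2 * (2 * (25 * n%:R ^+ 2 * `|z| ^+ 2)).
  rewrite normrM; apply: ler_pM => //; apply: le_trans (cut_sqr_taylor a0 b0) _.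
  by rewrite ler_wpM2l//; exact: sqnorm_diff_sqr_le.
have h2 : `|z ord0 i * (cut b ^+ 2 - cut a ^+ 2)|
    <= `|z| * (2 * (5 * n%:R * `|z|)).
  rewrite normrM; apply: ler_pM => //; first exact: coord_le_norm.
  apply: le_trans (cut_sqr_lipschitz a0 b0) _.
  by rewrite ler_wpM2l//; exact: sqnorm_diff_le.
have h3 : `|y ord0 i * (2 * cut a * sqnorm z)| <= 2 * (2 * (n%:R * `|z| ^+ 2)).
  rewrite normrM; apply: ler_pM => //.
  rewrite ger0_norm; last by rewrite !mulr_ge0 ?cut_ge0 ?sqnorm_ge0.
  rewrite -mulrA ler_wpM2l//; apply: (le_trans _ (sqnorm_le z)).
  by rewrite ler_piMl ?sqnorm_ge0 ?cut_le1.
apply: le_trans (ler_normD _ _) _.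
apply: le_trans (lerD h1 (le_trans (ler_normB _ _) (lerD h2 h3))) _.
by rewrite le_eqVlt; apply/orP; left; apply/eqP; ring.
Qed.

Lemma coord_bump_continuous n (i : 'I_n) k :
  continuous (fun y : 'rV[R]_n => y ord0 i * bump k y).
Proof. by apply: continuous_mulr; [exact: coord_continuous|exact: bump_continuous]. Qed.

Lemma coord_bump2_partial_continuous n (i j : 'I_n) :
  continuous (coord_bump2_partial i j).
Proof.
apply: continuous_subr; apply: continuous_mulr.
- exact: cst_continuous.
- exact: bump_continuous.
- exact: cst_continuous.
- apply: continuous_mulr; last exact: bump_continuous.
  by apply: continuous_mulr; exact: coord_continuous.
Qed.

Lemma coord_bump2_partial_supp n (i j : 'I_n) y :
  1 < `|y| -> coord_bump2_partial i j y = 0.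
Proof. by move=> y1; rewrite /coord_bump2_partial !bump_supp// !mulr0 subrr. Qed.

Lemma conv_scale n (k : R) (K g : 'rV[R]_n -> R) x :
  continuous K -> (forall y, 1 < `|y| -> K y = 0) -> continuous g ->
  conv (fun y => k * K y) g x = k * conv K g x.
Proof.
move=> cK K0 cg; rewrite /conv -RintegralZl//; last exact: conv_integrable.
by apply: eq_Rintegral => t _; rewrite mulrA.
Qed.

Lemma conv_sub n (K L g : 'rV[R]_n -> R) x :
  continuous K -> (forall y, 1 < `|y| -> K y = 0) ->
  continuous L -> (forall y, 1 < `|y| -> L y = 0) -> continuous g ->
  conv (fun y => K y - L y) g x = conv K g x - conv L g x.
Proof.
move=> cK K0 cL L0 cg; rewrite /conv -RintegralB//; try exact: conv_integrable.
by apply: eq_Rintegral => t _; rewrite mulrBl.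
Qed.

Lemma conv_sum n (K : 'I_n -> 'rV[R]_n -> R) g x :
  (forall i, continuous (K i)) -> (forall i y, 1 < `|y| -> K i y = 0) ->
  continuous g ->
  conv (fun y => \sum_(i < n) K i y) g x = \sum_(i < n) conv (K i) g x.
Proof.
move=> cK K0 cg; rewrite /conv -Rintegral_sum//.
  by apply: eq_Rintegral => t _; rewrite mulr_suml.
by move=> i; apply: conv_integrable => //; exact: K0.
Qed.

Section conv_bump.
Variables (n : nat) (g : 'rV[R]_n -> R).
Hypothesis cg : continuous g.

Lemma conv_bump3_differentiable x :
  differentiable (conv (bump 3) g) x /\
  forall i, partial i (conv (bump 3) g) x
    = 6 * conv (fun y => y ord0 i * bump 2 y) g x.
Proof.
have cD j : continuous (fun y : 'rV[R]_n => - 6 * (y ord0 j * bump 2 y)).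
  by apply: continuous_mulr; [exact: cst_continuous|exact: coord_bump_continuous].
have D0 (j : 'I_n) (y : 'rV[R]_n) : 1 < `|y| -> - 6 * (y ord0 j * bump 2 y) = 0.
  by move=> y1; rewrite bump_supp// !mulr0.
have [d p] := conv_differentiable (@bump_continuous n 3) cD (@bump_supp n 2) D0
  (@bump3_taylor n) cg x.
split => // i; rewrite p conv_scale//; first by rewrite mulNr opprK.
  exact: coord_bump_continuous.
by move=> y y1; rewrite bump_supp// mulr0.
Qed.

Lemma conv_coord_bump2_differentiable i x :
  differentiable (conv (fun y => y ord0 i * bump 2 y) g) x /\
  forall j, partial j (conv (fun y => y ord0 i * bump 2 y) g) x
    = - conv (coord_bump2_partial i j) g x.
Proof.
apply: (@conv_differentiable _ _ (fun y => y ord0 i * bump 2 y)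
  (coord_bump2_partial i) (100 * n%:R ^+ 2 + 14 * n%:R)) => //.
- exact: coord_bump_continuous.
- by move=> j; exact: coord_bump2_partial_continuous.
- by move=> y y1; rewrite bump_supp// mulr0.
- by move=> j y; exact: coord_bump2_partial_supp.
- exact: coord_bump2_taylor.
Qed.

Lemma partial2_conv_bump3 i x :
  partial i (partial i (conv (bump 3) g)) x = - 6 * conv (coord_bump2_partial i i) g x.
Proof.
have -> : partial i (conv (bump 3) g) = 6 *: conv (fun y => y ord0 i * bump 2 y) g.
  by apply/funext => y; have [_ ->] := conv_bump3_differentiable y.
have [d p] := conv_coord_bump2_differentiable i x.
rewrite /partial deriveZ; last exact: diff_derivable.
by rewrite -/(partial _ _ _) p scalerN -scaleNr.
Qed.

(** The kernel of the left-hand side is [- 6] times the sum over [i] of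
    [coord_bump2_partial i i y], that is [n bump 2 y - 4 |y|^2 bump 1 y]; inside the
    unit ball [|y|^2 = 1 - (1 - |y|^2)] turns [|y|^2 bump 1 y] into
    [bump 1 y - bump 2 y], so that only radially decreasing kernels remain. *)
Lemma laplacian_conv_bump3 x :
  \sum_(i < n) partial i (partial i (conv (bump 3) g)) x =
  - 6 * ((n%:R + 4) * conv (bump 2) g x - 4 * conv (bump 1) g x).
Proof.
under eq_bigr do rewrite partial2_conv_bump3.
rewrite -mulr_sumr -conv_sum//; last 2 first.
- by move=> i; exact: coord_bump2_partial_continuous.
- by move=> i y; exact: coord_bump2_partial_supp.
have cb k (c : R) : continuous (fun y : 'rV[R]_n => c * bump k y).
  by apply: continuous_mulr; [exact: cst_continuous|exact: bump_continuous].
have b0 k (c : R) (y : 'rV[R]_n) : 1 < `|y| -> c * bump k.+1 y = 0.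
  by move=> y1; rewrite bump_supp ?mulr0.
rewrite -[(n%:R + 4) * _]conv_scale//; [|exact: bump_continuous|exact: bump_supp].
rewrite -[4 * _]conv_scale//; [|exact: bump_continuous|exact: bump_supp].
rewrite -conv_sub//; [|exact: b0|exact: b0].
congr (_ * conv _ _ _); apply/funext => y.
rewrite /coord_bump2_partial sumrB -mulr_suml -mulr_sumr -mulr_suml.
under eq_bigr do rewrite eqxx.
rewrite sumr_const card_ord.
under eq_bigr do rewrite -expr2.
by rewrite -/(sqnorm y) /bump expr1 mul_cut -[true%:R *+ n]/(n%:R); ring.
Qed.

End conv_bump.

(** The change of variable [t |-> z - t] removes the dependence on the centre [z]. *)
Lemma conv_bump_cst n k (x y : 'rV[R]_n) :
  conv (@bump n k.+1) (cst 1) x = conv (bump k.+1) (cst 1) y.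
Proof.
suff H (z : 'rV[R]_n) : conv (@bump n k.+1) (cst 1) z = \int[mu]_t @bump n k.+1 (- t).
  by rewrite !H.
have cb := continuous_comp_shift (x := z) (@bump_continuous n k.+1).
rewrite /conv; under eq_Rintegral do rewrite /= mulr1.
have shiftE (t : 'rV[R]_n) : z - t - z = - t by rewrite addrAC subrr add0r.
rewrite (@Rintegral_reflect _ _ z _ (fun t => bump k.+1 (t - z)))//.
- by rewrite preimage_setT; apply: eq_Rintegral => t _; rewrite shiftE.
- exact: continuous_measurable_rV.
- rewrite preimage_setT; apply: (@csupp_integrable _ _ _ 0 1) => //.
    have -> : (fun t => bump k.+1 (z - t - z)) = bump k.+1 \o -%R.
      by apply/funext => t /=; rewrite shiftE.
    move=> t; apply: continuous_comp; last exact: bump_continuous.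
    exact: opp_continuous.
  by move=> t; rewrite subr0 shiftE => t1; rewrite bump_supp// normrN.
Qed.

(** The kernel is at least [2^-(k+1)] on the ball of radius [1/2]. *)
Lemma conv_bump_gt0 n k (x : 'rV[R]_n) : 0 < conv (@bump n k.+1) (cst 1) x.
Proof.
have h0 : 0 < 2^-1 :> R by rewrite invr_gt0.
have mB := measurable_euclidean_ball x h0.
pose c : R := 2^-1 ^+ k.+1.
have c0 : 0 < c by rewrite exprn_gt0.
apply: (@lt_le_trans _ _ (\int[mu]_(t in euclidean_ball x 2^-1) c)).
  by rewrite Rintegral_cst// mulr_gt0// euclidean_ball_gt0.
rewrite Rintegral_mkcond /conv; apply: le_Rintegral => //.
- have : mu.-integrable (euclidean_ball x 2^-1) (EFin \o cst c).
    by apply: integrable_euclidean_ball => //; exact: cst_continuous.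
  by rewrite (integrable_mkcond _ mB) restrict_EFin; exact.
- apply: conv_integrable; [exact: bump_continuous|exact: bump_supp|exact: cst_continuous].
move=> t _; rewrite patchE /= mulr1; case: ifPn => [|_]; last exact: bump_ge0.
rewrite inE euclidean_ballE//= => tx.
rewrite /c /bump ler_pXn2r ?nnegrE ?cut_ge0 ?invr_ge0// ltW//.
by rewrite /cut lt_max; apply/orP; right; lra.
Qed.

(** The mean value property makes [g] a multiple of [conv (bump 3) g], which is twice
    differentiable, and makes its Laplacian at [x] equal to [g x] times that of a
    multiple of [conv (bump 3) 1], a constant function. *)
Lemma harmonic_of_mean_value n (g : 'rV[R]_n -> R) : continuous g ->
  mean_value_property g -> harmonic_function g.
Proof.
move=> cg mg.
have rep k x : conv (bump k.+1) g x = g x * conv (bump k.+1) (cst 1) x.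
  apply: conv_mean_value => //; [exact: bump_ge0|exact: bump_continuous|
    exact: bump_supp|exact: bump_radially_decreasing].
pose N := conv (@bump n 3) (cst 1) 0.
have N0 : 0 < N by exact: conv_bump_gt0.
have gE : g = N^-1 *: conv (bump 3) g.
  apply/funext => x /=; rewrite -[RHS]/(N^-1 * conv (bump 3) g x) rep.
  by rewrite (conv_bump_cst 2 x 0) -/N mulrCA mulVf ?mulr1// gt_eqF.
have dg x : differentiable g x.
  by rewrite gE; apply: differentiableZ; have [] := conv_bump3_differentiable cg x.
have pg i : partial i g = N^-1 *: partial i (conv (bump 3) g).
  apply/funext => x; rewrite {1}gE /partial deriveZ//.
  by apply: diff_derivable; have [] := conv_bump3_differentiable cg x.
have dp i x : differentiable (partial i (conv (bump 3) g)) x.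
  have -> : partial i (conv (bump 3) g) = 6 *: conv (fun y => y ord0 i * bump 2 y) g.
    by apply/funext => y; have [_ ->] := conv_bump3_differentiable cg y.
  by apply: differentiableZ; have [] := conv_coord_bump2_differentiable cg i x.
split; first by split => // i x; rewrite pg; exact: differentiableZ.
move=> x.
have -> : \sum_(i < n) partial i (partial i g) x =
    N^-1 * \sum_(i < n) partial i (partial i (conv (bump 3) g)) x.
  rewrite mulr_sumr; apply: eq_bigr => i _.
  by rewrite pg {1}/partial deriveZ//; exact: diff_derivable.
have c1 : continuous (cst 1 : 'rV[R]_n -> R) by exact: cst_continuous.
have lap1 : - 6 * ((n%:R + 4) * conv (bump 2) (cst 1) x
    - 4 * conv (@bump n 1) (cst 1) x) = 0.
  rewrite -laplacian_conv_bump3// big1// => i _.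
  have -> : conv (@bump n 3) (cst 1) = cst N.
    by apply/funext => y; exact: conv_bump_cst.
  have -> : partial i (cst N) = cst 0 :> ('rV[R]_n -> R).
    by apply/funext => y; rewrite /partial derive_cst.
  by rewrite /partial derive_cst.
rewrite laplacian_conv_bump3// !rep.
set A := conv (bump 2) (cst 1) x in lap1 *.
set B := conv (bump 1) (cst 1) x in lap1 *.
transitivity (N^-1 * g x * (- 6 * ((n%:R + 4) * A - 4 * B))); first by ring.
by rewrite lap1 mulr0.
Qed.

End bump_kernels.

Theorem theorem2 (R : realType) (n : nat) (hn : (1 <= n)%N)
    (lam : R) (hlam : 0 < lam < 1)
    (v : 'rV[R]_n) (hv : euclidean_norm v = 1)
    (g : 'rV[R]_n -> R) (hg : continuously_differentiable g)
    (hmean : forall (x : 'rV[R]_n) (h : R), 0 < h ->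
       g (x + ((1 - 2 * lam) * h) *: v) = ball_mean g x h) :
  harmonic_function g /\
  (lam != 1 / 2 -> forall x : 'rV[R]_n, 'D_v g x = 0).
Proof.
have [dg _] := hg.
have cg : continuous g by move=> x; exact: differentiable_continuous.
have Dv0 : lam != 1 / 2 -> forall x : 'rV[R]_n, 'D_v g x = 0.
  move=> lam_half x.
  apply: (derive_eq0_of_shifted_mean (c := 1 - 2 * lam) cg (dg x)) => [|h].
    by apply: contra lam_half => /eqP c0; apply/eqP; lra.
  exact: hmean.
split => //; apply: harmonic_of_mean_value => // x h h0.
rewrite -hmean//; have [->|/Dv0 Dv] := eqVneq lam (1 / 2).
  by rewrite (_ : (_ - _) * _ = 0) ?scale0r ?addr0//; field.
by rewrite derive_eq0_translate.
Qed.
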